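(* Let $\mathbf a=(a_1,\dots,a_n)$ be the truthful profile, let $\tau$ be the deadline, and let $\mathbf b$ be the ballot profile induced by $\mathbf a$, i.e. $b_i=\mathrm{top}_i(C)$. Then the process $CUD(\mathcal F^{IMaj}_\sigma,\tau)$, $\frac n2<\sigma\le n$, stops with some $w\in C^+$ as the winner if and only if there is an alternative $c\in C^+$ whose score $\mathrm{sc}_c(\mathbf b)=|\{i\in V: b_i=c\}|$ satisfies $\mathrm{sc}_c(\mathbf b)\ge\sigma-\tau$.
   Context: Setting (Consensus Under a Deadline, CUD). $V=\{1,\dots,n\}$ is a finite set of $n$ voters, $C$ is a finite set of $m+1$ alternatives containing a default alternative $\psi$; $C^+=C\setminus\{\psi\}$ is the set of valid alternatives ($|C^+|=m\ge 1$). Each voter $i$ has a truthful preference $a_i$, a strict linear order on $C$; $a_i(c,c')$ means that $i$ prefers $c$ to $c'$. It is assumed that $a_i(c,\psi)$ for all $i\in V$, $c\in C^+$. For nonempty $W\subseteq C$, $\mathrm{top}_i(W)$ is the $a_i$-best element of $W$. The deadline $\tau$ is a nonnegative integer and the threshold $\sigma$ is an integer with $\frac n2<\sigma\le n$. Time $t$ counts the remaining steps, running down from $\tau$ to $0$. Scores. For a ballot profile $b^t=(b^t_1,\dots,b^t_n)\in C^n$, $s^t_c=|\{i\in V: b^t_i=c\}|$, and $s^t=(s^t_c)_{c\in C^+}$ is the score vector. For a score vector $s$ and $c\in C$, $s+c$ (resp. $s-c$) is $s$ with the score of $c$ increased (resp. decreased) by 1. Possible winners and voting rule. $\widehat W(s,t)=\{c\in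 C^+ : \sigma-s_c<t+1\}$ is the set of possible winners. $\mathcal F(s,t)=\mathcal F^{IMaj}_\sigma(s,t)$ equals $\{\psi\}$ if $\widehat W(s,t)=\emptyset$ and equals $\widehat W(s,t)$ otherwise. Utilities. Each voter has a utility $u_i(s,t)\in\mathbb R$ on score vectors $s$ and times $t\in\{0,\dots,\tau\}$. With $w=\mathrm{top}_i(\mathcal F(s,t))$ and $w'=\mathrm{top}_i(\mathcal F(s',t))$: $u_i$ is lazy consistent if for all $s,s',t$: $u_i(s,t)>u_i(s',t)\iff a_i(w,w')$; $u_i$ is proactive consistent if for all $s,s',t$: $u_i(s,t)>u_i(s',t)\iff a_i(w,w')$ or ($w=w'$ and $s_w>s'_w$), where for $w=w'=\psi$ neither side is strictly better. Either all voters are lazy consistent or all are proactive consistent. Process. Initially $t=\tau$ and $b^\tau_i=\mathrm{top}_i(C)$ for all $i$. At time $t$: if $\mathcal F(s^t,t)=\{w\}$ is a singleton, the process stops and $w$ is the outcome (the winner if $w\in C^+$; the default if $w=\psi$). Otherwise each voter $i$ computes a best response $w_i\in\arg\max_{c\in C}u_i(s^t-b^t_i+c,\,t-1)$, where $w_i=b_i^t$ if $b_i^t$ is itself a maximizer (a voter changes only for a strict improvement), and otherwise ties among maximizers are broken by $a_i$ (the $a_i$-best maximizer is chosen). Let $I=\{i: w_i\ne b^t_i\}$. If $I\neq\emptyset$, one $j\in I$ is chosen uniformly at random and $b^{t-1}_j=w_j$, $b^{t-1}_i=b^t_i$ for $i\ne j$; if $I=\emptyset$, $b^{t-1}=b^t$.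 Then $t$ is replaced by $t-1$. At $t=0$ the set $\mathcal F(s^0,0)$ is always a singleton because $\sigma>n/2$. A run is any realization of the random choices; the statement holds for every run. *)

(* Defs.v *)
From mathcomp Require Import all_boot all_order all_algebra.
From mathcomp Require Import reals.

Set Implicit Arguments.
Unset Strict Implicit.
Unset Printing Implicit Defensive.

Import Order.TTheory GRing.Theory Num.Theory.

Local Open Scope nat_scope.

(** Strict preferences; [r c d] reads "[c] is preferred to [d]". *)
Definition strict_linear_order (C : finType) (r : rel C) : Prop :=
  [/\ irreflexive r, transitive r & forall c d : C, c != d -> r c d || r d c].

(** The [r]-best element of [W]. The default value [c0] is returned only if
    there is none, which never happens when [W] is nonempty and [r] is a strict
    linear order. *)
Definition top (C : finType) (c0 : C) (r : rel C) (W : {set C}) : C :=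
  odflt c0 [pick c in W | [forall d in W, (d != c) ==> r c d]].

(** The valid alternatives C^+. *)
Definition valid (C : finType) (psi : C) : Type := {c : C | c != psi}.

(** Score vectors have no coordinate for the default alternative [psi]. *)
Definition scores (C : finType) (psi : C) : Type := {ffun valid psi -> nat}.

Section Scores.

Variables (n : nat) (C : finType) (psi : C).

Definition profile : Type := {ffun 'I_n -> C}.

Definition sc (b : profile) (c : C) : nat := #|[set i : 'I_n | b i == c]|.

Definition score (b : profile) : scores psi :=
  [ffun c : valid psi => sc b (val c)].

(** [s + c] and [s - c] for [c : C]; both are [s] itself if [c] is [psi]. *)
Definition add_vote (s : scores psi) (c : C) : scores psi :=
  [ffun d : valid psi => s d + (val d == c)].

Definition sub_vote (s : scores psi) (c : C) : scores psi :=
  [ffun d : valid psi => s d - (val d == c)].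

(** Truncated subtraction is harmless here: if [sigma <= s c] then the
    inequality holds, as it does over the integers. *)
Definition possible_winners (sigma : nat) (s : scores psi) (t : nat) : {set C} :=
  [set val c | c : valid psi & sigma - s c < t.+1].

(** The voting rule F^IMaj_sigma. *)
Definition IMaj (sigma : nat) (s : scores psi) (t : nat) : {set C} :=
  if possible_winners sigma s t == set0 then [set psi]
  else possible_winners sigma s t.

End Scores.

Section Voter.

Variables (R : realType) (n : nat) (C : finType) (psi : C) (sigma tau : nat).
Variables (r : rel C) (u : scores psi -> nat -> R).

Let favourite (s : scores psi) (t : nat) : C := top psi r (IMaj sigma s t).

(** Consistency is required on the score vectors of ballot profiles of the [n]
    voters, at times [t <= tau]. *)
Definition lazy_consistent : Prop :=
  forall (b b' : profile n C) (t : nat), t <= tau ->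
    let s := score psi b in let s' := score psi b' in
    (u s' t < u s t)%R <-> r (favourite s t) (favourite s' t).

(** A common favourite equal to [psi] is not of the form [val c], so it never
    gives a strict preference. *)
Definition proactive_consistent : Prop :=
  forall (b b' : profile n C) (t : nat), t <= tau ->
    let s := score psi b in let s' := score psi b' in
    (u s' t < u s t)%R <->
      (r (favourite s t) (favourite s' t) \/
       exists c : valid psi,
         [/\ favourite s t = val c, favourite s' t = val c & s' c < s c]).

(** The alternatives maximizing the utility, at time [t], of a voter replacing
    its ballot [c0] in [s]. *)
Definition maximizers (s : scores psi) (c0 : C) (t : nat) : {set C} :=
  [set c | [forall d : C,
     (u (add_vote (sub_vote s c0) d) t <= u (add_vote (sub_vote s c0) c) t)%R]].

Definition best_response (s : scores psi) (c0 : C) (t : nat) : C :=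
  if c0 \in maximizers s c0 t then c0 else top psi r (maximizers s c0 t).

End Voter.

Section Process.

Variables (R : realType) (n : nat) (C : finType) (psi : C) (sigma tau : nat).
Variables (a : 'I_n -> rel C) (u : 'I_n -> scores psi -> nat -> R).

Definition truthful : profile n C := [ffun i => top psi (a i) [set: C]].

(** The ballot w_i, when [t] steps remain after the current one. *)
Definition response (b : profile n C) (t : nat) (i : 'I_n) : C :=
  best_response (a i) (u i) (score psi b) (b i) t.

Definition movers (b : profile n C) (t : nat) : {set 'I_n} :=
  [set i | response b t i != b i].

(** [step b t b']: from ballots [b] at time [t.+1], the ballots at time [t] can
    be [b']. The uniform random choice of the moving voter gives positive
    probability to exactly the elements of [movers b t]. *)
Definition step (b : profile n C) (t : nat) (b' : profile n C) : Prop :=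
  if movers b t == set0 then b' = b
  else exists2 j, j \in movers b t &
         b' = [ffun i => if i == j then response b t j else b i].

Definition stopping (b : profile n C) (t : nat) : bool :=
  #|IMaj sigma (score psi b) t| == 1.

(** A run is given by the ballot profile [b t] at each remaining time [t],
    counted down from [tau]; the values of [b] after the process has stopped
    (and beyond [tau]) are irrelevant and unconstrained. *)
Definition run (b : nat -> profile n C) : Prop :=
  b tau = truthful /\
  forall t, t < tau ->
    (forall t', t < t' <= tau -> ~~ stopping (b t') t') ->
    step (b t.+1) t (b t).

(** The run [b] stops, at the first time [F] is a singleton, with outcome [w]. *)
Definition stops_with (b : nat -> profile n C) (w : C) : Prop :=
  exists t, [/\ t <= tau,
    forall t', t < t' <= tau -> ~~ stopping (b t') t' &
    IMaj sigma (score psi (b t)) t = [set w]].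

End Process.

(* Main.v *)
(** If two alternatives are possible winners when [t.+1] steps remain, then any
    voter [i] can vote for one of them other than its current ballot, and this
    alternative stays a possible winner when [t] steps remain. Every voter ranks
    each valid alternative above [psi], so no best response leaves the set of
    possible winners empty: the set stays nonempty until the process stops, and
    it has at most one element at time [0] because [sigma] is a strict majority.
    If the set is empty at time [tau], the process stops there with [psi]. *)

Require Import Defs.
From mathcomp Require Import all_boot all_order all_algebra.
From mathcomp Require Import reals.

Set Implicit Arguments.
Unset Strict Implicit.
Unset Printing Implicit Defensive.

Import Order.TTheory GRing.Theory Num.Theory.

Local Open Scope nat_scope.

(** The element of [W] with the most elements of [C] ranked below it is best: by transitivity and
    irreflexivity, any [d] preferred to it would have strictly more. *)
Lemma top_in (C : finType) (c0 : C) (r : rel C) (W : {set C}) :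
  strict_linear_order r -> W != set0 -> top c0 r W \in W.
Proof.
move=> [r_irr r_trans r_total] /set0Pn[w0 w0W]; rewrite /top.
case: pickP => [c /andP[]//|no_best].
pose rank c := #|[set d | r c d]|.
case: (arg_maxnP (P := mem W) rank w0W) => w wW rank_max.
have := no_best w; rewrite /= (wW : w \in W) => /negP[].
apply/forall_inP => d dW; apply/implyP => dw.
have /orP[//|rdw] : r w d || r d w by apply: r_total; rewrite eq_sym.
have: rank d <= rank w := rank_max d dW; rewrite leqNgt => /negP[]; apply: proper_card.
apply/properP; split; last by exists w; rewrite !inE ?rdw ?r_irr.
by apply/subsetP => e; rewrite !inE; apply: r_trans.
Qed.

Lemma maximizers_neq0 (R : realType) (C : finType) (psi : C)
    (u : scores psi -> nat -> R) (s : scores psi) (c0 : C) (t : nat) :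
  maximizers u s c0 t != set0.
Proof.
pose f c := u (add_vote (sub_vote s c0) c) t.
have := @arg_maxP _ R C psi predT f isT.
case=> c _ c_max; apply/set0Pn; exists c; rewrite inE.
by apply/forallP => d; apply: c_max.
Qed.

Lemma best_response_maximizer (R : realType) (C : finType) (psi : C) (r : rel C)
    (u : scores psi -> nat -> R) (s : scores psi) (c0 : C) (t : nat) :
  strict_linear_order r -> best_response r u s c0 t \in maximizers u s c0 t.
Proof.
move=> r_slo; rewrite /best_response; case: ifP => // _.
exact/top_in/maximizers_neq0.
Qed.

Definition change_ballot (n : nat) (C : finType) (b : profile n C) (j : 'I_n)
    (c : C) : profile n C :=
  [ffun i => if i == j then c else b i].

Lemma change_ballot_id (n : nat) (C : finType) (b : profile n C) (j : 'I_n) :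
  change_ballot b j (b j) = b.
Proof. by apply/ffunP => i; rewrite ffunE; case: eqP => // ->. Qed.

(** The truncated subtraction is exact: if [d] is [b j], then voter [j] counts in [sc b d]. *)
Lemma sc_change_ballot (n : nat) (C : finType) (b : profile n C) (j : 'I_n)
    (c d : C) :
  sc (change_ballot b j c) d = sc b d - (d == b j) + (d == c).
Proof.
rewrite /sc (cardsD1 j) [in RHS](cardsD1 j) !inE ffunE eqxx.
rewrite [b j == d]eq_sym addKn addnC [c == d]eq_sym; congr (#|pred_of_set _| + _).
by apply/setP => i; rewrite !inE ffunE; case: (i == j).
Qed.

(** Shows that the score vectors compared in [maximizers] come from ballot profiles, so that the
    consistency hypotheses apply to them. *)
Lemma score_change_ballot (n : nat) (C : finType) (psi : C) (b : profile n C)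
    (j : 'I_n) (c : C) :
  score psi (change_ballot b j c) = add_vote (sub_vote (score psi b) (b j)) c.
Proof. by apply/ffunP => d; rewrite !ffunE sc_change_ballot. Qed.

Lemma possible_winnersP (n : nat) (C : finType) (psi : C) (sigma : nat)
    (b : profile n C) (t : nat) (c : C) :
  (c \in possible_winners sigma (score psi b) t)
    = (c != psi) && (sigma <= sc b c + t).
Proof.
apply/imsetP/andP => [[d]|[c_psi c_sc]].
  by rewrite inE ffunE ltnS leq_subLR => d_sc ->; split; first exact: (valP d).
by exists (Sub c c_psi : valid psi); rewrite // inE ffunE ltnS leq_subLR.
Qed.

Section Voter.

Variables (R : realType) (n : nat) (C : finType) (psi : C) (sigma tau : nat).
Variables (r : rel C) (u : scores psi -> nat -> R).
Hypothesis r_slo : strict_linear_order r.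
Hypothesis r_psi : forall c, c != psi -> r c psi.
Hypothesis u_consistent :
  lazy_consistent n sigma tau r u \/ proactive_consistent n sigma tau r u.

Let W (b : profile n C) (t : nat) := possible_winners sigma (score psi b) t.

(** The favourites are a valid alternative and [psi]. A strict preference between favourites raises
    utility under both notions of consistency, so one argument serves both. *)
Lemma ltr_utility_possible_winners (b b' : profile n C) (t : nat) :
  t <= tau -> W b t != set0 -> W b' t = set0 ->
  (u (score psi b') t < u (score psi b) t)%R.
Proof.
move=> t_tau Wb Wb'.
have fav_lt : r (top psi r (IMaj sigma (score psi b) t))
                (top psi r (IMaj sigma (score psi b') t)).
  have -> : top psi r (IMaj sigma (score psi b') t) = psi.
    rewrite /IMaj -/(W b' t) Wb' eqxx; apply/set1P/top_in => //.
    by apply/set0Pn; exists psi; rewrite inE.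
  apply: r_psi; rewrite /IMaj -/(W b t) (negPf Wb).
  by have := top_in psi r_slo Wb; rewrite possible_winnersP => /andP[].
by case: u_consistent => /(_ b b' t t_tau)[_]; apply; [|left].
Qed.

Lemma best_response_possible_winners (b : profile n C) (i : 'I_n) (t : nat)
    (c : C) :
  t <= tau -> c \in maximizers u (score psi b) (b i) t ->
  1 < #|W b t.+1| -> W (change_ballot b i c) t != set0.
Proof.
move=> t_tau; rewrite inE => /forallP c_max W_gt1.
have /set0Pn[d] : W b t.+1 :\ b i != set0.
  by rewrite -card_gt0; move: W_gt1; rewrite (cardsD1 (b i)); case: (b i \in _) => // /ltnW.
rewrite !inE possible_winnersP => /and3P[d_bi d_psi d_sc].
(* The vote that [d] gains makes up for the elapsed time unit; it loses none, being different from
   [b i]. *)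
have Wd : W (change_ballot b i d) t != set0.
  apply/set0Pn; exists d; rewrite possible_winnersP d_psi sc_change_ballot.
  by rewrite (negPf d_bi) eqxx subn0 -addnA.
apply/negP => /eqP Wc.
have := ltr_utility_possible_winners t_tau Wd Wc.
by rewrite ltNge !score_change_ballot c_max.
Qed.

End Voter.

(** With no time left, a possible winner holds [sigma] votes already; two of them would have
    disjoint sets of supporters, hence [2 * sigma <= n]. *)
Lemma card_possible_winners0 (n : nat) (C : finType) (psi : C) (sigma : nat)
    (b : profile n C) :
  n < 2 * sigma -> #|possible_winners sigma (score psi b) 0| <= 1.
Proof.
move=> hsigma; apply/card_le1_eqP => c d.
rewrite !possible_winnersP !addn0 => /andP[_ sc_c] /andP[_ sc_d].
apply/eqP/negPn/negP => d_c; move: hsigma; rewrite ltnNge => /negP[].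
rewrite mul2n -addnn (leq_trans (leq_add sc_c sc_d)) // /sc -cardsUI.
rewrite [X in _ + X](_ : _ = 0) ?addn0.
  by rewrite -[leqRHS]card_ord max_card.
apply/eqP; rewrite cards_eq0; apply/eqP/setP => i; rewrite !inE.
by have [->|//] := eqVneq (b i) c; rewrite eq_sym (negPf d_c).
Qed.

Theorem corollary1 (R : realType) (n m : nat) (C : finType) (psi : C)
    (hC : #|C| = m.+1) (hm : 1 <= m)
    (a : 'I_n -> rel C)
    (ha : forall i : 'I_n, strict_linear_order (a i))
    (hpsi : forall (i : 'I_n) (c : C), c != psi -> a i c psi)
    (sigma tau : nat) (hsigma : n < 2 * sigma) (hsigman : sigma <= n)
    (u : 'I_n -> scores psi -> nat -> R)
    (hu : (forall i : 'I_n, lazy_consistent n sigma tau (a i) (u i)) \/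
          (forall i : 'I_n, proactive_consistent n sigma tau (a i) (u i)))
    (b : nat -> profile n C) (hb : run sigma tau a u b) :
  (exists w : C, w != psi /\ stops_with psi sigma tau b w) <->
  (exists c : C, c != psi /\ sigma - tau <= sc (truthful psi a) c).
Proof.
case: (hb) => b_tau b_step.
pose W t := possible_winners sigma (score psi (b t)) t.
have u_consistent i : lazy_consistent n sigma tau (a i) (u i) \/
    proactive_consistent n sigma tau (a i) (u i).
  by case: hu => hu'; [left|right].
(* The score condition says exactly that some alternative is a possible winner at the start. *)
have -> : (exists c, c != psi /\ sigma - tau <= sc (truthful psi a) c) <->
    W tau != set0.
  split=> [[c [c_psi c_sc]]|/set0Pn[c]].
    by apply/set0Pn; exists c; rewrite possible_winnersP c_psi b_tau addnC -leq_subLR.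
  rewrite possible_winnersP b_tau addnC -leq_subLR => /andP[c_psi c_sc].
  by exists c.
split=> [[w [w_psi [t [t_tau running Iw]]]]|W_tau].
  apply/negP => /eqP W_tau.
  have I_tau : IMaj sigma (score psi (b tau)) tau = [set psi].
    by rewrite /IMaj -/(W tau) W_tau eqxx.
  move: t_tau; rewrite leq_eqVlt => /predU1P[t_tau|t_tau].
    by move: Iw w_psi; rewrite t_tau I_tau => /set1_inj ->; rewrite eqxx.
  by have := running tau; rewrite t_tau leqnn /stopping I_tau cards1 => /(_ isT).
pose won := exists w, w != psi /\ stops_with psi sigma tau b w.
have stop t : t <= tau -> (forall t', t < t' <= tau ->
    ~~ stopping psi sigma (b t') t') -> W t != set0 -> #|W t| = 1 -> won.
  move=> t_tau running Wt /eqP/cards1P[w Ww]; exists w; split.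
    have : w \in W t by rewrite Ww inE.
    by rewrite possible_winnersP => /andP[].
  by exists t; split=> //; rewrite /IMaj -/(W t) (negPf Wt).
(* Time runs downwards, so the invariant is proved by induction on the number [k] of elapsed
   steps. *)
have advance k : k <= tau -> won \/ W (tau - k) != set0 /\
    forall t', tau - k < t' <= tau -> ~~ stopping psi sigma (b t') t'.
  elim: k => [_|k IHk k_tau].
    by right; rewrite subn0; split=> // t' /andP[/leq_trans h /h]; rewrite ltnn.
  have [|[]] := IHk (ltnW k_tau); first by left.
  have -> : tau - k = (tau - k.+1).+1 by rewrite subnSK.
  have t_tau : tau - k.+1 < tau by rewrite -subSn // subSS leq_subr.
  move: (tau - k.+1) t_tau => t t_tau Wt running.
  have [W1|W_neq1] := eqVneq #|W t.+1| 1; first by left; apply: stop W1.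
  have running' t' : t < t' <= tau -> ~~ stopping psi sigma (b t') t'.
    rewrite leq_eqVlt => /andP[/predU1P[<- _|lt_t' le_t']]; last first.
      by apply: running; rewrite lt_t'.
    by rewrite /stopping /IMaj -/(W t.+1) (negPf Wt).
  right; split=> //.
  have W_gt1 : 1 < #|W t.+1| by rewrite ltn_neqAle eq_sym W_neq1 card_gt0.
  have W_response i :
    possible_winners sigma
      (score psi (change_ballot (b t.+1) i (response a u (b t.+1) t i))) t != set0.
    apply: (best_response_possible_winners (ha i) (hpsi i) (u_consistent i)) => //.
      exact: ltnW.
    exact: best_response_maximizer.
  have := b_step t t_tau running'; rewrite /step.
  case: ifP => [/eqP no_movers|_ [j _]]; rewrite /W => ->; last exact: W_response.
  (* Without movers, the unchanged profile is the one where an arbitrary voter casts its response. A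
     voter exists: [n = 0] would force [sigma = 0], against [n < 2 * sigma]. *)
  have n_gt0 : 0 < n by case: (n) hsigma hsigman => //; case: (sigma).
  pose i := Ordinal n_gt0.
  have := W_response i.
  have /eqP -> : response a u (b t.+1) t i == b t.+1 i.
    by have := in_set0 i; rewrite -no_movers inE => /negbFE.
  by rewrite change_ballot_id.
have [//|] := advance tau (leqnn _); rewrite subnn => -[W0 running].
apply: (stop 0) => //; apply/eqP.
by rewrite eqn_leq card_gt0 W0 card_possible_winners0.
Qed.
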